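(* Let $(G,\sigma)$ be a signed graph and let $(H,\pi)$ be an elementary homomorphic image of $(G,\sigma)$. Then $$\chi(G,\sigma)\le\chi(H,\pi)\le\chi(G,\sigma)+1.$$
   Context: A signed graph $(G,\sigma)$ is a finite simple graph $G$ with a signature $\sigma:E(G)\to\{-,+\}$. Switching a set $S\subseteq V(G)$ changes the sign of every edge with exactly one end in $S$. For $k\ge1$ let $M_k=\{-n,\dots,-1,+1,\dots,+n\}$ if $k=2n$, and $M_k=\{-n,\dots,-1,\pm0,+1,\dots,+n\}$ if $k=2n+1$, where $\pm0$ is a single colour with $-(\pm0)=\pm0$. A $k$-colouring $\phi:V(G)\to M_k$ is proper if $\phi(u)\ne\sigma(uv)\phi(v)$ for every edge $uv$ (where $\sigma(uv)\phi(v)=\phi(v)$ if $\sigma(uv)=+$ and $-\phi(v)$ otherwise). The chromatic number $\chi(G,\sigma)$ is the smallest $k\ge1$ such that $(G,\sigma)$ admits a proper $k$-colouring. Two vertices $u,v$ of $(G,\sigma)$ are identifiable if they are non-adjacent and, after possibly switching $u$ or $v$, $\sigma(uw)=\sigma(vw)$ for every common neighbour $w$ of $u$ and $v$. An elementary homomorphic image of $(G,\sigma)$ is the signed graph obtained from $(G,\sigma)$ (after this possible switching) by identifying two identifiable vertices $u,v$ into a single vertex adjacent to all neighbours of $u$ and of $v$, each such edge keeping its sign (the result being simple). *)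

(* Defs.v *)
From mathcomp Require Import all_boot all_order all_algebra.

Set Implicit Arguments.
Unset Strict Implicit.
Unset Printing Implicit Defensive.

Import Order.TTheory GRing.Theory Num.Theory.

Local Open Scope nat_scope.

(** [negative x y] is only meaningful when [adj x y]: the edge [xy] has sign
    [-] if it is [true] and [+] if it is [false]. *)
Record signed_graph (V : finType) := SignedGraph {
  adj : rel V;
  negative : rel V;
  adj_sym : symmetric adj;
  adj_irrefl : irreflexive adj;
  negative_sym : forall x y, adj x y -> negative x y = negative y x
}.

Section Switching.
Variables (V : finType) (G : signed_graph V) (S : {set V}).

Definition switch_negative : rel V :=
  fun x y => negative G x y (+) ((x \in S) (+) (y \in S)).

Lemma switch_negative_sym x y :
  adj G x y -> switch_negative x y = switch_negative y x.
Proof.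
by move=> xy; rewrite /switch_negative (negative_sym xy) (addbC (x \in S)).
Qed.

Definition switch : signed_graph V :=
  SignedGraph (adj_sym G) (adj_irrefl G) switch_negative_sym.

End Switching.

(** The colour [±0] is the integer [0]; for [k = 2n] or [k = 2n+1], [n = k./2]. *)
Definition colours (k : nat) : seq int :=
  [seq (- (Posz i))%R | i <- rev (iota 1 k./2)]
  ++ nseq (odd k) 0%R
  ++ [seq Posz i | i <- iota 1 k./2].

Section Colouring.
Variables (V : finType) (G : signed_graph V).

Definition signed_colour (neg : bool) (c : int) : int :=
  if neg then (- c)%R else c.

Definition proper (phi : V -> int) : bool :=
  [forall x, forall y,
     adj G x y ==> (phi x != signed_colour (negative G x y) (phi y))].

Definition colourable (k : nat) : bool :=
  [exists phi : {ffun V -> seq_sub (colours k)}, proper (fun x => ssval (phi x))].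

Lemma colourable_exists : exists k, (0 < k) && colourable k.
Proof.
exists (#|V|.*2.+1); apply/andP; split=> //.
have col (x : V) : Posz (enum_rank x).+1 \in colours #|V|.*2.+1.
  rewrite /colours !mem_cat; apply/orP; right; apply/orP; right.
  apply: map_f; rewrite mem_iota /= uphalf_double add1n !ltnS.
  exact: ltn_ord.
apply/existsP; exists [ffun x => SeqSub (col x)].
apply/forallP=> x; apply/forallP=> y; apply/implyP=> xy.
rewrite !ffunE /= /signed_colour; case: negative => //.
rewrite eqz_nat eqSS; apply: contraTN xy => /eqP/val_inj/enum_rank_inj ->.
by rewrite adj_irrefl.
Qed.

Definition chromatic_number : nat := ex_minn colourable_exists.

End Colouring.

Section ElementaryImage.
Variables (V : finType) (G : signed_graph V).

Definition agree_on_common_neighbours (G' : signed_graph V) (u v : V) : Prop :=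
  forall w, adj G' u w -> adj G' v w -> negative G' u w = negative G' v w.

(** [S] records the optional switching of [u] or [v]; [u] and [v] are
    identifiable when this holds for some [S]. *)
Definition identifiable_after (S : {set V}) (u v : V) : Prop :=
  [/\ u != v, ~~ adj G u v,
      S \in [:: set0; [set u]; [set v]]
    & agree_on_common_neighbours (switch G S) u v].

End ElementaryImage.

(** [H] is obtained from [G] by identifying [u] and [v], up to isomorphism:
    [f] is the quotient map, its only nontrivial fibre is [{u, v}], and the
    edges of [H] are exactly the images of those of [G], with their signs. *)
Definition is_identification (V W : finType) (G : signed_graph V)
    (H : signed_graph W) (u v : V) (f : V -> W) : Prop :=
  [/\ forall a, exists x, f x = a,
      forall x y, f x = f y <->
        [\/ x = y, x = u /\ y = v | x = v /\ y = u],
      forall a b, adj H a b <->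
        exists x y, [/\ f x = a, f y = b & adj G x y]
    & forall x y, adj G x y -> negative H (f x) (f y) = negative G x y].

Definition elementary_homomorphic_image (V W : finType)
    (G : signed_graph V) (H : signed_graph W) : Prop :=
  exists (u v : V) (S : {set V}) (f : V -> W),
    identifiable_after G S u v /\ is_identification (switch G S) H u v f.

(* Main.v *)
Require Import Defs.
From mathcomp Require Import all_boot all_order all_algebra.
From mathcomp Require Import zify.

Set Implicit Arguments.
Unset Strict Implicit.
Unset Printing Implicit Defensive.

(** A colour pair [{n, -n}] with [n > 0] can be used on any vertex set inducing
    an antibalanced subgraph, i.e. one that switches to an all-negative graph,
    while the colour [0] can only be used on a stable set. Identification
    homomorphisms pull colourings back, which gives the lower bound. Conversely,
    a [k]-colouring of [G] colours [H] away from the merged vertex [w], and one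
    more colour lets it extend to [w]: if [k] is even, [w] receives the new
    colour [0]; if [k] is odd, the stable set coloured [0] forms a star together
    with [w], and a star is antibalanced, so [0] can be traded for a new pair of
    colours. *)

Lemma signed_colourK (b : bool) : involutive (signed_colour b).
Proof. by case: b => c //=; rewrite GRing.opprK. Qed.

Lemma signed_colour_addb (b b' : bool) (c : int) :
  signed_colour (b (+) b') c = signed_colour b (signed_colour b' c).
Proof. by case: b; case: b' => //=; rewrite GRing.opprK. Qed.

Lemma eq_signed_colour_switch (b s t : bool) (c d : int) :
  (signed_colour s c == signed_colour b (signed_colour t d))
  = (c == signed_colour (b (+) (s (+) t)) d).
Proof.
by rewrite (inv_eq (signed_colourK s)) -!signed_colour_addb -addbA addbCA.
Qed.

Lemma absz_signed_colour (b : bool) (c : int) :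
  absz (signed_colour b c) = absz c.
Proof. by case: b => //=; rewrite abszN. Qed.

Lemma neq_signed_colour (b : bool) (c d : int) :
  absz c != absz d -> c != signed_colour b d.
Proof. by apply: contraNneq => ->; rewrite absz_signed_colour. Qed.

Lemma mem_signed_iota (b : bool) (n : nat) (c : int) :
  (c \in [seq signed_colour b (Posz i) | i <- iota 1 n])
  = [&& c != 0%R, absz c <= n & b == (c < 0)%R].
Proof.
apply/mapP/and3P => [[i]|[c0 cn /eqP->]].
  by rewrite mem_iota => i_in ->; case: b => /=; split; lia.
by exists (absz c); rewrite ?mem_iota /signed_colour; [|case: ifP]; lia.
Qed.

Lemma mem_colours (k : nat) (c : int) :
  (c \in colours k) = (absz c <= k./2) && (odd k || (c != 0%R)).
Proof.
rewrite /colours !mem_cat mem_nseq lt0b map_rev mem_rev.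
rewrite (mem_signed_iota true) (mem_signed_iota false).
by case: (odd k) => /=; lia.
Qed.

Lemma mem_colours_double (n : nat) (c : int) :
  (c \in colours n.*2) = (absz c <= n) && (c != 0%R).
Proof. by rewrite mem_colours odd_double doubleK. Qed.

Lemma mem_colours_doubleS (n : nat) (c : int) :
  (c \in colours n.*2.+1) = (absz c <= n).
Proof. by rewrite mem_colours /= odd_double uphalf_double andbT. Qed.

Lemma mem_colours_signed (k : nat) (b : bool) (c : int) :
  (signed_colour b c \in colours k) = (c \in colours k).
Proof. by rewrite !mem_colours -!absz_eq0 absz_signed_colour. Qed.

Section Colourings.
Variables (V : finType) (G : signed_graph V).
Implicit Types (A B : {set V}) (phi psi : V -> int) (k : nat).

Definition proper_on A phi : Prop :=
  {in A &, forall x y, adj G x y ->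
     phi x != signed_colour (negative G x y) (phi y)}.

Definition colourable_on A k : Prop :=
  exists2 phi, {in A, forall x, phi x \in colours k} & proper_on A phi.

Lemma properP phi : reflect (proper_on [set: V] phi) (Defs.proper G phi).
Proof.
apply: (iffP forallP) => [phiP x y _ _ xy|phiP x].
  by have /forallP/(_ y)/implyP := phiP x; apply.
by apply/forallP => y; apply/implyP; apply: phiP; rewrite inE.
Qed.

Lemma colourableP k : reflect (colourable_on [set: V] k) (colourable G k).
Proof.
apply: (iffP existsP) => [[phi /properP phiP]|[phi phik phiP]].
  by exists (fun x => ssval (phi x)) => // x _; apply: ssvalP.
exists [ffun x => SeqSub (phik x (in_setT x))].
by apply/properP => x y xT yT xy; rewrite !ffunE; apply: phiP.
Qed.

Lemma chromatic_number_gt0 : 0 < chromatic_number G.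
Proof. by rewrite /chromatic_number; case: ex_minnP => m /andP[]. Qed.

Lemma colourable_chromatic_number : colourable G (chromatic_number G).
Proof. by rewrite /chromatic_number; case: ex_minnP => m /andP[]. Qed.

Lemma chromatic_number_le k :
  0 < k -> colourable G k -> chromatic_number G <= k.
Proof.
move=> k0 Gk; rewrite /chromatic_number; case: ex_minnP => m _.
by apply; rewrite k0.
Qed.

Lemma proper_on_setU A B phi psi :
  proper_on A phi -> proper_on B psi ->
  {in A & B, forall x y, absz (phi x) != absz (psi y)} ->
  proper_on (A :|: B) (fun x => if x \in B then psi x else phi x).
Proof.
move=> phiP psiP neq_abs x y; rewrite !inE.
have [xB|_] := boolP (x \in B); have [yB|_] := boolP (y \in B);
  rewrite ?orbT ?orbF => xAB yAB xy.
- exact: psiP.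
- by apply: neq_signed_colour; rewrite eq_sym neq_abs.
- by apply: neq_signed_colour; apply: neq_abs.
- exact: phiP.
Qed.

End Colourings.

Section Switching.
Variables (V : finType) (G : signed_graph V).
Implicit Types (A S : {set V}) (k : nat).

Lemma proper_on_switch S A (phi : V -> int) :
  proper_on (switch G S) A phi <->
  proper_on G A (fun x => signed_colour (x \in S) (phi x)).
Proof.
by split=> phiP x y xA yA xy; have := phiP x y xA yA xy;
  rewrite eq_signed_colour_switch.
Qed.

Lemma colourable_on_switch S A k :
  colourable_on (switch G S) A k <-> colourable_on G A k.
Proof.
split=> -[phi phik phiP]; exists (fun x => signed_colour (x \in S) (phi x));
  try by move=> x xA; rewrite mem_colours_signed phik.
- exact/proper_on_switch.
- apply/proper_on_switch => x y xA yA xy; rewrite /= !signed_colourK.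
  exact: phiP.
Qed.

End Switching.

Section Extension.
Variables (V : finType) (G : signed_graph V).
Implicit Types (A B Z : {set V}) (k n : nat).

Definition stable A : Prop := {in A &, forall x y, ~~ adj G x y}.

Definition antibalanced A : Prop :=
  exists S, {in A &, forall x y, adj G x y -> negative (switch G S) x y}.

Lemma stable_set1 w : stable [set w].
Proof. by move=> x y /set1P-> /set1P->; rewrite adj_irrefl. Qed.

Lemma antibalanced_star w Z : stable Z -> antibalanced (w |: Z).
Proof.
move=> stZ; exists [set x | (x != w) && ~~ negative G x w] => x y.
rewrite !inE /= /switch_negative !inE.
have [->|xw] := eqVneq x w; have [->|yw] := eqVneq y w => //= xZ yZ xy.
- by rewrite adj_irrefl in xy.
- by rewrite (negative_sym xy) addbN addbb.
- by rewrite addbF addbN addbb.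
- by have := stZ _ _ xZ yZ; rewrite xy.
Qed.

Lemma colourable_on_setU_stable A Z n :
  stable Z -> colourable_on G A n.*2 -> colourable_on G (A :|: Z) n.*2.+1.
Proof.
move=> stZ [phi phin phiP].
exists (fun x => if x \in Z then 0%R else phi x) => [x|].
  rewrite inE mem_colours_doubleS; case: ifP => //= _; rewrite orbF => /phin.
  by rewrite mem_colours_double => /andP[].
apply: proper_on_setU => // [x y xZ yZ|x y /phin].
  by rewrite (negPf (stZ _ _ xZ yZ)).
by rewrite mem_colours_double absz_eq0 => /andP[].
Qed.

Lemma colourable_on_setU_antibalanced A B n :
  antibalanced B -> colourable_on G A n.*2 -> colourable_on G (A :|: B) n.+1.*2.
Proof.
move=> [S negB] [phi phin phiP]; pose c := Posz n.+1.
exists (fun x => if x \in B then signed_colour (x \in S) c else phi x) => [x|].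
  rewrite inE; case: ifP => [_ _|_].
    by rewrite mem_colours_signed mem_colours_double /= leqnn.
  rewrite orbF => /phin; rewrite !mem_colours_double => /andP[xn ->].
  by rewrite ltnW.
apply: proper_on_setU => // [|x y /phin].
  by apply/proper_on_switch => x y xB yB xy; rewrite negB.
rewrite mem_colours_double absz_signed_colour => /andP[xn _] _.
by rewrite ltn_eqF.
Qed.

Lemma colourable_on_odd_stable A n :
  colourable_on G A n.*2.+1 ->
  exists Z, [/\ Z \subset A, stable Z & colourable_on G (A :\: Z) n.*2].
Proof.
move=> [phi phin phiP]; exists [set x in A | phi x == 0%R]; split.
- by apply/subsetP => x; rewrite inE => /andP[].
- move=> x y; rewrite !inE => /andP[xA /eqP x0] /andP[yA /eqP y0].
  apply/negP => /(phiP _ _ xA yA).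
  by rewrite x0 y0 /signed_colour GRing.oppr0 if_same.
- exists phi => [x|x y /setDP[xA _] /setDP[yA _]]; last exact: phiP.
  rewrite !inE mem_colours_double => /andP[+ xA]; rewrite xA => /= ->.
  by have := phin x xA; rewrite mem_colours_doubleS => ->.
Qed.

Lemma colourable_on_setU1 w A k :
  colourable_on G A k -> colourable_on G (w |: A) k.+1.
Proof.
rewrite -(odd_double_half k); case: (odd k) => /= Ak.
  have [Z [ZA stZ AZk]] := colourable_on_odd_stable Ak.
  have -> : w |: A = (A :\: Z) :|: (w |: Z).
    by rewrite setUCA (setUC (A :\: Z)) -{1}(setIidPr ZA) setID.
  by apply: colourable_on_setU_antibalanced AZk; apply: antibalanced_star.
by rewrite setUC; apply: colourable_on_setU_stable Ak; apply: stable_set1.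
Qed.

End Extension.

Section Homomorphisms.
Variables (V W : finType) (G : signed_graph V) (H : signed_graph W).

Definition homomorphism_on (A : {set V}) (f : V -> W) : Prop :=
  {in A &, forall x y, adj G x y ->
     adj H (f x) (f y) /\ negative H (f x) (f y) = negative G x y}.

Lemma colourable_on_homomorphism (A : {set V}) (B : {set W}) (f : V -> W)
    (k : nat) :
  homomorphism_on A f -> {in A, forall x, f x \in B} ->
  colourable_on H B k -> colourable_on G A k.
Proof.
move=> hom_f fAB [phi phik phiP]; exists (phi \o f) => [x /fAB/phik //|].
move=> x y xA yA /(hom_f _ _ xA yA)[fxy <-] /=.
by apply: phiP => //; apply: fAB.
Qed.

Lemma identification_homomorphism (u v : V) (f : V -> W) :
  is_identification G H u v f -> homomorphism_on [set: V] f.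
Proof.
case=> _ _ adjH negH x y _ _ xy; split; last exact: negH.
by apply/adjH; exists x, y.
Qed.

End Homomorphisms.

Lemma identification_section_homomorphism (V W : finType) (G : signed_graph V)
    (H : signed_graph W) (u v : V) (f : V -> W) :
  is_identification G H u v f ->
  exists g : W -> V, homomorphism_on H G [set~ f u] g.
Proof.
case=> surj_f fibre_f adjH negH; have [g gK] := fin_all_exists surj_f.
have fvu : f v = f u by apply/fibre_f; constructor 3.
have fK x : f x \in [set~ f u] -> g (f x) = x.
  rewrite !inE => xu; have /fibre_f[//|[_ xv]|[_ xu']] := gK (f x).
    by rewrite xv fvu eqxx in xu.
  by rewrite xu' eqxx in xu.
exists g => a b aw bw /adjH[x [y [fx fy xy]]].
by rewrite -fx -fy in aw bw *; rewrite !fK // negH.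
Qed.

Theorem theorem3p9 (V W : finType) (G : signed_graph V) (H : signed_graph W)
    (GH : elementary_homomorphic_image G H) :
  chromatic_number G <= chromatic_number H
  /\ chromatic_number H <= chromatic_number G + 1.
Proof.
case: GH => [u [v [S [f [_ ident_f]]]]].
have hom_f := identification_homomorphism ident_f.
have [g hom_g] := identification_section_homomorphism ident_f.
have [/colourableP GkG /colourableP HkH] :=
  (colourable_chromatic_number G, colourable_chromatic_number H).
rewrite addn1; split; apply: chromatic_number_le;
  rewrite ?chromatic_number_gt0 //; apply/colourableP.
- apply/(colourable_on_switch _ S).
  exact: colourable_on_homomorphism hom_f _ HkH.
- rewrite -(setUCr [set f u]); apply: colourable_on_setU1.
  apply: colourable_on_homomorphism hom_g _ _ => //.
  exact/colourable_on_switch.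
Qed.
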